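(* Let $d\in\mathbb{N}$. (Time-homogeneous) nonlinear Markov processes are not uniquely determined by their one-dimensional time marginals: there exist a set $\mathcal P_0\subseteq\mathcal P(\mathbb R^d)$ and two nonlinear Markov processes $\{P^\zeta\}_{\zeta\in\mathcal P_0}$ and $\{Q^\zeta\}_{\zeta\in\mathcal P_0}$ such that $P^\zeta\circ\pi_t^{-1}=Q^\zeta\circ\pi_t^{-1}$ for all $\zeta\in\mathcal P_0$ and $t\ge 0$, but $P^\zeta\neq Q^\zeta$ for some $\zeta\in\mathcal P_0$.
   Context: $\mathbb R_+=[0,\infty)$. $\mathcal P(T)$ is the set of Borel probability measures on a topological space $T$; $\mathcal P:=\mathcal P(\mathbb R^d)$. $\mathcal C:=C(\mathbb R_+;\mathbb R^d)$ carries the topology of locally uniform convergence and its Borel $\sigma$-algebra; $\pi_t(w)=w(t)$ and $\mathcal F_t=\sigma(\pi_s:0\le s\le t)$. A (time-homogeneous) nonlinear Markov process with initial class $\mathcal P_0\subseteq\mathcal P$ is a family $\{P^\zeta\}_{\zeta\in\mathcal P_0}\subset\mathcal P(\mathcal C)$ such that, with $\mu^\zeta_t:=P^\zeta\circ\pi_t^{-1}$: (i) $\mu_0^\zeta=\zeta$ for all $\zeta\in\mathcal P_0$; (ii) $\mu^\zeta_t\in\mathcal P_0$ for all $t>0$, $\zeta\in\mathcal P_0$; (iii) for all $s,t\ge 0$, $\zeta\in\mathcal P_0$, $A\in\mathcal B(\mathbb R^d)$, $$P^\zeta(\pi_{t+s}\in A\mid\mathcal F_s)(\cdot)=P^{\mu^\zeta_s,\pi_s(\cdot)}(\pi_t\in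 A)\quad P^\zeta\text{-a.s.},$$ where for $\eta\in\mathcal P_0$, $\{P^{\eta,y}\}_{y\in\mathbb R^d}$ is the ($\eta$-a.e. unique) disintegration of $P^\eta$ with respect to $\pi_0$: $y\mapsto P^{\eta,y}(B)$ is measurable, $P^\eta(B)=\int P^{\eta,y}(B)\,d\eta(y)$ for all $B\in\mathcal B(\mathcal C)$, and $P^{\eta,y}(\pi_0=y)=1$ for $\eta$-a.e. $y$. *)

(* Defs.v *)
From HB Require Import structures.
From mathcomp Require Import all_boot all_order all_algebra.
From mathcomp Require Import all_classical all_reals all_analysis.
From mathcomp Require Import measurable_realfun giry.

Set Implicit Arguments.
Unset Strict Implicit.
Unset Printing Implicit Defensive.

Import Order.TTheory GRing.Theory Num.Theory.
Import numFieldNormedType.Exports.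

Local Open Scope classical_set_scope.
Local Open Scope ring_scope.

Section half_line.
Variable R : realType.

Definition Rplus : set R := [set x | 0 <= x].

Lemma Rplus0_subproof : (0 : R) \in Rplus.
Proof. by apply/mem_set; exact: lexx. Qed.

Definition Rplus0 : Rplus := exist _ 0 Rplus0_subproof.

Lemma Rplus_add_subproof (s t : Rplus) : val s + val t \in Rplus.
Proof.
by apply/mem_set; exact: addr_ge0 (set_valP s) (set_valP t).
Qed.

Definition Rplus_add (s t : Rplus) : Rplus :=
  exist _ (val s + val t) (Rplus_add_subproof s t).

End half_line.
Arguments Rplus : clear implicits.
Arguments Rplus0 {R}.

Section path_space.
Variables (R : realType) (d : nat).

Definition borelRd := g_sigma_algebraType (@open 'rV[R]_d).

HB.instance Definition _ := Measurable.on borelRd.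

Definition paths := continuousType (Rplus R) 'rV[R]_d.

HB.instance Definition _ := Choice.on paths.

Lemma cst_path_subproof : continuous (fun _ : Rplus R => 0 : 'rV[R]_d).
Proof. exact: cst_continuous. Qed.

HB.instance Definition _ := isPointed.Build paths (mkcts cst_path_subproof).

(* The half-line being locally compact, locally uniform convergence is uniform
   convergence on compact sets. *)
HB.instance Definition _ := Topological.copy paths
  (initial_topology
    (fun w : paths => (w : {family compact, Rplus R -> 'rV[R]_d}))).

Definition borel_paths := g_sigma_algebraType (@open paths).

HB.instance Definition _ := Measurable.on borel_paths.

Definition proj (t : Rplus R) (w : borel_paths) : borelRd := (w : paths) t.

Lemma proj_continuous (t : Rplus R) :
  continuous (fun w : paths => (w : Rplus R -> 'rV[R]_d) t).
Proof.
apply/continuousP => U oU.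
have ptw : continuous
    (fun f : {family compact, Rplus R -> 'rV[R]_d} => f t).
  move=> f; have ff : Filter (nbhs f) by exact: nbhs_filter.
  have [+ _] := pointwise_cvgP f ff; apply.
  by apply: pointwise_cvg_compact_family; exact: cvg_id.
exists ((fun f : {family compact, Rplus R -> 'rV[R]_d} => f t) @^-1` U) => //.
by move/continuousP : ptw; exact.
Qed.

Lemma measurable_proj (t : Rplus R) :
  measurable_fun [set: borel_paths] (proj t).
Proof.
apply: (@measurability _ _ borel_paths borelRd setT (proj t)
  (@open 'rV[R]_d)) => //.
move=> _ [U oU <-]; rewrite setTI; apply: sub_gen_smallest.
by move/continuousP : (@proj_continuous t); exact.
Qed.

HB.instance Definition _ (t : Rplus R) :=
  isMeasurableFun.Build _ _ borel_paths borelRd (proj t) (measurable_proj t).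

Definition filtration (t : Rplus R) : set (set borel_paths) :=
  <<s \bigcup_(s in [set s : Rplus R | val s <= val t])
        preimage_set_system [set: borel_paths] (proj s) measurable >>.

Lemma filtration_measurable (t : Rplus R) : filtration t `<=` measurable.
Proof.
apply: smallest_sub; first exact: sigma_algebra_measurable.
by move=> _ [s _ [Y mY <-]]; exact: measurable_proj.
Qed.

End path_space.

Section conditional_probability.
Context {dT : measure_display} {T : measurableType dT} {R : realType}.
Local Open Scope ereal_scope.

(* [f] is a version of P(B | G), for a sub-sigma-algebra G *)
Definition is_cond_prob (P : probability T R) (G : set (set T)) (B : set T)
    (f : T -> \bar R) : Prop :=
  [/\ preimage_set_system [set: T] f measurable `<=` G,
      P.-integrable [set: T] f &
      forall A, G A -> \int[P]_(x in A) f x = P (A `&` B)].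

End conditional_probability.

Section nonlinear_Markov_process.
Context {R : realType} {d : nat}.
Local Open Scope ereal_scope.

Notation probRd := (probability (borelRd R d) R).
Notation probC := (probability (borel_paths R d) R).

Definition marginal (P : probC) (t : Rplus R) : probRd :=
  distribution P (proj t).

Definition is_disintegration (P : probC)
    (k : R.-pker borelRd R d ~> borel_paths R d) : Prop :=
  (forall B, measurable B -> P B = \int[marginal P Rplus0]_y k y B) /\
  {ae marginal P Rplus0, forall y, k y (proj Rplus0 @^-1` [set y]) = 1}.

(* Elements of [probability T R] are set functions defined on all subsets of
   [T], so two of them represent the same measure as soon as they agree on
   measurable sets, which is [measure_eq]. A class of measures and a family
   indexed by it have to be compatible with this equivalence. *)
Definition proper_class (P0 : set probRd) : Prop :=
  forall eta zeta : probRd, eta ≡μ zeta -> P0 eta -> P0 zeta.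

Definition proper_family (P0 : set probRd) (P : probRd -> probC) : Prop :=
  forall eta zeta : probRd, P0 eta -> P0 zeta -> eta ≡μ zeta ->
    P eta ≡μ P zeta.

(* The values of [P] and [k] outside [P0] are irrelevant. *)
Definition nonlinear_Markov (P0 : set probRd) (P : probRd -> probC) : Prop :=
  [/\ proper_class P0 /\ proper_family P0 P,
      forall zeta, P0 zeta -> marginal (P zeta) Rplus0 ≡μ zeta,
      forall zeta (t : Rplus R), P0 zeta -> (0 < val t)%R ->
        P0 (marginal (P zeta) t) &
      exists k : probRd -> R.-pker borelRd R d ~> borel_paths R d,
        (forall eta, P0 eta -> is_disintegration (P eta) (k eta)) /\
        forall (s t : Rplus R) zeta (A : set (borelRd R d)),
          P0 zeta -> measurable A ->
          exists2 f, is_cond_prob (P zeta) (filtration s)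
                       (proj (Rplus_add t s) @^-1` A) f &
            {ae P zeta, forall w,
              f w = k (marginal (P zeta) s) (proj s w) (proj t @^-1` A)}].

End nonlinear_Markov_process.

(* Main.v *)
Require Import Defs.
From HB Require Import structures.
From mathcomp Require Import all_boot all_order all_algebra.
From mathcomp Require Import all_classical all_reals all_analysis.
From mathcomp Require Import measurable_realfun giry.
From mathcomp Require Import lra.

Set Implicit Arguments.
Unset Strict Implicit.
Unset Printing Implicit Defensive.

Import Order.TTheory GRing.Theory Num.Theory.
Import numFieldNormedType.Exports.

Local Open Scope classical_set_scope.
Local Open Scope ring_scope.

(** On the line, let an atom of mass 1/2 move to the right at unit speed, from
    [a] until it stops at 1, through a background of mass 1/2 spread uniformly
    over the interval from 0 to 1. When the atom is at [a], the particles are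
    distributed as [profile a]; this is all that the one-dimensional marginals
    show, and two different motions of the particles produce it. In the first
    one, [carry], the particles of the atom travel together and the background
    stands still. In the second one, [exchange], the atom picks up every
    background particle that it reaches and drops its own particles at unit
    rate, so that it leaves behind exactly as much mass as it takes in.

    Both motions are Markov in the nonlinear sense. The current marginal
    reveals where the atom is, so the position of a particle tells whether
    the particle is still ahead of the atom, is riding in it, or is behind it.
    Given this, the past is irrelevant for the future: the riding time is
    exponential, hence memoryless, in the second motion; in the first one a
    background particle can be mistaken for a particle of the atom only while
    the two meet, which at any given time concerns a set of background
    particles of measure zero. The laws differ because a particle starting in
    the atom at 0 is still in it at time 1 with probability 1 in the first
    motion and [expR (- 1)] in the second. The diagonal embedding of the line
    transfers the example to every positive dimension.

    In both motions a particle waits at some point [x], rides from there with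
    the atom, and is left at some point [y >= x]; a particle that never
    rides has [x = y]. Its path is [t |-> max x (min (front a t) y)], and a
    motion is a rule giving [y] from [a], [x] and a uniform variable. Lemma
    [nonlinear_Markov_law] isolates what a rule has to satisfy: particles
    behind the atom do not move ([keeps_behind]), profiles are mapped to
    profiles ([transports]), and the point where a particle is left is, given
    the present position, independent of the past ([forgets]). For
    [exchange], the second property is the balance
    [exchange_transports], a consequence of the integral of the exponential,
    and the third one follows from [drop_point_memoryless]. *)

(** * Measurability of a family of continuous paths *)

Section topology.
Context {R : realType}.

(** Boxes with rational centres and radii form a countable base of the plane,
    so the product sigma-algebra contains its open sets. *)
Lemma open_measurable2 (W : set (R * R)) : open W -> measurable W.
Proof.
move=> oW.
pose box (q : (rat * rat) * rat) : set (R * R) :=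
  ball (ratr q.1.1 : R) (ratr q.2) `*` ball (ratr q.1.2 : R) (ratr q.2).
have -> : W = \bigcup_(q in [set q | box q `<=` W]) box q.
  apply/seteqP; split=> [[x y] Wxy|z [q qW qz]]; last exact: qW.
  have : nbhs (x, y) W by apply: open_nbhs_nbhs.
  rewrite -nbhs_ballE => -[e /= e0 eW].
  have [r r0 re] : exists2 r : rat, (0 < ratr r :> R) & (ratr r < e / 2 :> R).
    have /rat_in_itvoo[r] : 0 < e / 2 by rewrite divr_gt0.
    by rewrite in_itv/= => /andP[]; exists r.
  have approx (z : R) : exists q : rat, ball (ratr q : R) (ratr r) z.
    have /rat_in_itvoo[q] : z - ratr r < z + ratr r by lra.
    by rewrite in_itv/= => qP; exists q; rewrite /ball/= ltr_distl.
  have [p px] := approx x; have [q qy] := approx y.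
  exists ((p, q), r); last by split.
  move=> [u v] [/= pu qv]; apply: eW; split => /=.
    apply: (@ball_split _ _ (ratr p : R)); apply: le_ball (ltW re) _ _ => //.
    exact: ball_sym.
  apply: (@ball_split _ _ (ratr q : R)); apply: le_ball (ltW re) _ _ => //.
  exact: ball_sym.
rewrite bigcup_mkcond; apply: countable_bigcupT_measurable => // q.
by case: ifPn => // _; apply: measurableX; apply: open_measurable; exact: ball_open.
Qed.

End topology.

Section paths.
Context {R : realType} {d : nat}.

(** The events that do not separate [w] from [w'] form a sigma-algebra, and it
    contains the generators of [filtration s]. *)
Lemma filtration_agree (s : Rplus R) (G : set (borel_paths R d))
    (w w' : borel_paths R d) :
  filtration s G ->
  (forall u : Rplus R, (val u <= val s)%R -> Defs.proj u w = Defs.proj u w') ->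
  G w -> G w'.
Proof.
move=> sG ww'; suff : G w <-> G w' by case.
apply: (sG [set G | G w <-> G w']); split.
- split => /=.
  + by [].
  + by move=> A /= wA; split=> -[_ nA]; split=> // /wA.
  + by move=> F /= wF; split=> -[n _ Fn]; exists n => //; apply/wF.
- by move=> _ [u us [Y mY <-]]; rewrite /= (ww' _ us).
Qed.

(** A jointly continuous map is continuous, once curried, for the compact-open
    topology, which on continuous functions is the topology of uniform
    convergence on compact sets. *)
Lemma measurable_path_map (f : R * R -> Rplus R -> 'rV[R]_d)
    (F : R * R -> paths R d) :
  (forall z t, F z t = f z t) ->
  continuous (fun u : (R * R) * Rplus R => f u.1 u.2) ->
  measurable_fun [set: R * R] (F : R * R -> borel_paths R d).
Proof.
move=> Ff cf; apply: (@measurability _ _ _ (borel_paths R d) setT F (@open (paths R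
  d))) => //.
move=> _ [W oW <-]; rewrite setTI; apply: open_measurable2.
case: oW => O oO <-.
pose g : R * R -> {family compact, Rplus R -> 'rV[R]_d} := f.
have -> : F @^-1` ((fun w : paths R d => (w :
  {family compact, Rplus R -> 'rV[R]_d})) @^-1` O) = g @^-1` O.
  apply/seteqP; split => z /=; rewrite (_ : (F z : Rplus R -> 'rV[R]_d) = f z)//;
    exact/funext.
have cg : continuous g.
  move=> z.
  have [cfun cpt] := continuous_curry cf.
  apply/(compact_open_fam_compactP _).
  - exact: cpt.
  - exact: cfun.
by move/continuousP : cg; exact.
Qed.

(** The diagonal, which serves all dimensions at once. *)
Definition embed (x : R) : borelRd R d := const_mx x.

(** The trajectory of the atom. It stops at 1, where the background ends. *)
Definition front (a t : R) : R := Num.min (a + t) 1.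

(** When the atom is at [b], this is the position of a particle that waits for
    it at [z.1] and is left by it at [z.2]. *)
Definition pos (b : R) (z : R * R) : R := Num.max z.1 (Num.min b z.2).

Lemma le_frontr (a t : R) : (a <= 1 -> 0 <= t -> a <= front a t)%R.
Proof. by move=> a1 t0; rewrite /front le_min a1 lerDl t0. Qed.

Lemma front_le1 (a t : R) : (front a t <= 1)%R.
Proof. by rewrite /front ge_min lexx orbT. Qed.

Lemma front0 (a : R) : (a <= 1)%R -> front a 0 = a.
Proof. by move=> a1; rewrite /front addr0 min_l. Qed.

Lemma front_add (a s t : R) : (0 <= t -> front a (s + t) = front (front a s) t)%R.
Proof.
move=> t0; rewrite /front addr_minl addrA -minA; congr Num.min.
by rewrite [RHS]min_r// lerDl.
Qed.

Lemma le_front (a u s : R) : (u <= s)%R -> (front a u <= front a s)%R.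
Proof. by move=> us; rewrite /front le_min !ge_min lexx orbT lerD2l us. Qed.

Lemma pos_diag b x : pos b (x, x) = x.
Proof. by rewrite /pos /= max_l// ge_min lexx orbT. Qed.

Lemma measurable_pos b : measurable_fun [set: R * R] (pos b).
Proof. by apply: measurable_maxr => //; apply: measurable_minr. Qed.

Definition path_fun (a : R) (z : R * R) (t : Rplus R) : 'rV[R]_d :=
  embed (pos (front a (val t)) z).

Lemma continuous_embed : continuous (embed : R -> 'rV[R]_d).
Proof.
move=> x; apply/cvg_ballP => e e0; have := nbhsx_ballx x e e0.
by apply: filterS => y xy; split => // i j; rewrite !mxE.
Qed.

Lemma continuous_path_fun a : continuous (fun u :
  (R * R) * Rplus R => path_fun a u.1 u.2).
Proof.
move=> u; rewrite /path_fun; apply: continuous_comp; last exact: continuous_embed.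
have c1 : {for u, continuous (fun u : (R * R) * Rplus R => u.1.1)}.
  by apply: (continuous_comp (f := fst)); exact: cvg_fst.
have c2 : {for u, continuous (fun u : (R * R) * Rplus R => u.1.2)}.
  by apply: (continuous_comp (f := fst)); [exact: cvg_fst|exact: cvg_snd].
have c3 : {for u, continuous (fun u : (R * R) * Rplus R => a + val u.2)}.
  apply: continuousD; first exact: cvg_cst.
  by apply: (continuous_comp (f := snd)); [exact: cvg_snd|exact: initial_continuous].
apply: continuous_max => //; apply: continuous_min => //.
by apply: continuous_min => //; exact: cvg_cst.
Qed.

Lemma continuous_path_fun1 a z : continuous (path_fun a z).
Proof.
by have [_ +] := continuous_curry (@continuous_path_fun a); exact.
Qed.

Definition trajectory (a : R) (z : R * R) : borel_paths R d :=
  mkcts (@continuous_path_fun1 a z).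

Lemma measurable_trajectory a : measurable_fun [set: R * R] (trajectory a).
Proof.
exact: (measurable_path_map _ (@continuous_path_fun a)).
Qed.

Lemma proj_trajectory a z (t : Rplus R) : Defs.proj t (trajectory a z) = embed (pos
  (front a (val t)) z).
Proof. by []. Qed.
End paths.

(** * The diagonal *)

Section embedding.
Context {R : realType} {d : nat}.
Local Open Scope ereal_scope.

Lemma measurable_embed : measurable_fun [set: R] (embed : R -> borelRd R d).
Proof.
apply: (@measurability _ _ _ (borelRd R d) setT embed (@open 'rV[R]_d)) => //.
move=> _ [W oW <-]; rewrite setTI; apply: open_measurable.
by move/continuousP : (@continuous_embed R d); exact.
Qed.

HB.instance Definition _ := isMeasurableFun.Build _ _ _ _
  (embed : R -> borelRd R d) measurable_embed.

Definition coord (y : borelRd R d.+1) : R := (y : 'rV[R]_d.+1) ord0 ord0.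

Lemma measurable_coord : measurable_fun [set: borelRd R d.+1] coord.
Proof.
apply: (@measurability _ _ (borelRd R d.+1) R setT coord _ (RGenOpens.measurableE R)).
move=> _ [W [a [b ->]] <-]; rewrite setTI; apply: sub_gen_smallest => /=.
have /continuousP := @coord_continuous R 1 d.+1 ord0 ord0.
by apply; exact: interval_open.
Qed.

Lemma embedK x : coord (@embed R d.+1 x) = x.
Proof. by rewrite /coord /embed mxE. Qed.

(** The complement of the diagonal is the null set off which the
    disintegrations charge the paths with the prescribed starting point. *)
Lemma measurable_range_embed : measurable (range (@embed R d.+1)).
Proof.
have -> : range (@embed R d.+1) = ~` ((fun y :
  'rV[R]_d.+1 => y - embed (coord y))%R @^-1` [set~ 0%R]).
  apply/seteqP; split => [y [x _ <-] /=|y].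
    by rewrite embedK subrr.
  by move=> /contrapT /= /subr0_eq ye; exists (coord y).
apply: measurableC; apply: sub_gen_smallest.
have oC : open ([set~ 0%R] : set 'rV[R]_d.+1).
  by apply: closed_openC; apply: accessible_closed_set1; apply: hausdorff_accessible;
    exact: norm_hausdorff.
have cc : continuous (fun y : 'rV[R]_d.+1 => embed (coord y) : 'rV[R]_d.+1).
  move=> y; apply: (@continuous_comp _ _ _ (fun y : 'rV[R]_d.+1 => y ord0 ord0)
    (embed : R -> 'rV[R]_d.+1)); last exact: continuous_embed.
  exact: coord_continuous.
suff /continuousP : continuous (fun y : 'rV[R]_d.+1 => y - embed (coord y))%R by exact.
move=> y; apply: (@continuousB _ _ _ (fun y : 'rV[R]_d.+1 => y)
  (fun y => embed (coord y) : 'rV[R]_d.+1)); first exact: cvg_id.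
exact: cc.
Qed.

End embedding.

(** * The profile of the particles *)

Section noise.
Context {R : realType}.
Local Open Scope ereal_scope.

(* [R] and [measurableTypeR R] have the same measurable sets in structures with
   different displays; pushing the uniform law through the identity moves it
   from the second one to the first one. *)
Let idR : measurableTypeR R -> R := idfun.

Let measurable_idR : measurable_fun setT idR.
Proof. by move=> _ B mB; rewrite setTI. Qed.

HB.instance Definition _ := isMeasurableFun.Build _ _ _ _ idR measurable_idR.

Definition noise : probability R R := distribution (uniform_prob (@ltr01 R)) idR.

Lemma noiseE (A : set R) : measurable A ->
  noise A = lebesgue_measure (A `&` `[0%R, 1%R]).
Proof.
move=> mA; rewrite /noise /distribution /pushforward /=.
rewrite /uniform_prob integral_uniform_pdf.
rewrite (eq_integral (fun=> 1%:E)); last first.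
  move=> x; rewrite inE => -[_ /=]; rewrite in_itv/= /uniform_pdf => ->.
  by rewrite subr0 invr1.
by rewrite integral_cst ?mul1e//; exact: measurableI.
Qed.

Lemma noise_set1 (x : R) : noise [set x] = 0.
Proof.
rewrite noiseE//; apply/eqP; rewrite eq_le measure_ge0 andbT.
rewrite -(lebesgue_measure_set1 x); apply: le_measure; rewrite ?inE//.
exact: measurableI.
Qed.

Lemma integral_noise (f : R -> \bar R) : measurable_fun setT f ->
  (forall x, 0 <= f x) ->
  \int[noise]_x f x = \int[lebesgue_measure]_(x in `[0%R, 1%R]) f x.
Proof.
move=> mf f0.
rewrite /noise ge0_integral_pushforward//.
rewrite preimage_setT /= integral_uniform//.
by rewrite subr0 invr1 mul1e.
Qed.

Definition half : {nonneg R} := ((2^-1)%:nng)%R.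

(** The distribution of the particles when the atom is at [a]. *)
Definition profile (a : R) : set R -> \bar R :=
  mscale half (measure_add \d_a noise).

HB.instance Definition _ a := Measure.on (profile a).

Lemma profileE a A : profile a A = (2^-1)%R%:E * (\d_a A + noise A).
Proof. by congr (_ * _); exact: measure_addE. Qed.

Let profile_setT a : profile a setT = 1.
Proof.
rewrite profileE diracT probability_setT -EFinD -EFinM mulVf//.
Qed.

HB.instance Definition _ a := Measure_isProbability.Build _ _ _ (profile a)
  (@profile_setT a).

Lemma integral_profile a (f : R -> \bar R) : measurable_fun setT f ->
  (forall x, 0 <= f x) ->
  \int[profile a]_x f x = (2^-1)%R%:E * (f a + \int[noise]_x f x).
Proof.
move=> mf f0.
rewrite ge0_integral_mscale// ge0_integral_measure_add// integral_dirac//.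
by rewrite diracT mul1e.
Qed.

End noise.

(** * The law of a particle *)

Section laws.
Context {R : realType} {d : nat}.
Local Open Scope ereal_scope.
Variable g : R -> {mfun (R * R)%type >-> R}.

(** [g a (x, v)] is the point where the atom, initially at [a], leaves a
    particle starting from [x] when the uniform variable takes the value
    [v]. *)
Definition run (a : R) (z : R * R) : borel_paths R d := trajectory a (z.1, g a z).

Lemma measurable_run a : measurable_fun [set: R * R] (run a).
Proof.
apply: (measurableT_comp (measurable_trajectory a)).
by apply/measurable_fun_pair => //=.
Qed.

HB.instance Definition _ a := isMeasurableFun.Build _ _ _ _ (run a) (measurable_run a).

Definition law (a : R) : probability (borel_paths R d) R :=
  distribution (profile a \x noise) (run a).

Definition run_from (a x v : R) : borel_paths R d := run a (x, v).

Lemma measurable_run_from a x : measurable_fun [set: R] (run_from a x).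
Proof.
by apply: (measurableT_comp (measurable_run a)); exact: measurable_pair1.
Qed.

HB.instance Definition _ a x := isMeasurableFun.Build _ _ _ _ (run_from a x)
  (measurable_run_from a x).

Lemma lawE a (B : set (borel_paths R d)) :
  law a B = \int[profile a]_x noise (run_from a x @^-1` B).
Proof.
rewrite /law /distribution /pushforward /= /product_measure1.
by apply: eq_integral => x _ /=; congr (noise _); apply/seteqP; split => v;
  rewrite /xsection /= inE.
Qed.

Lemma measurable_noise_run_from a (B : set (borel_paths R d)) : measurable B ->
  measurable_fun setT (fun x => noise (run_from a x @^-1` B)).
Proof.
move=> mB.
have mrB : measurable (run a @^-1` B).
  by rewrite -[X in measurable X]setTI; exact: measurable_run.
have -> : (fun x => noise (run_from a x @^-1` B)) = noise \o xsection (run a @^-1` B).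
  apply/funext => y /=; congr (noise _); apply/seteqP; split => v;
  by rewrite /xsection /= inE.
exact: measurable_fun_xsection.
Qed.

Lemma integral_law a (G : set (borel_paths R d)) (f : borel_paths R d -> \bar R) :
  measurable G -> measurable_fun setT f -> (forall w, 0 <= f w) ->
  measurable_fun setT (fun x => \int[noise]_(v in run_from a x @^-1` G) f (run_from
    a x v)) /\
  \int[law a]_(w in G) f w =
  \int[profile a]_x \int[noise]_(v in run_from a x @^-1` G) f (run_from a x v).
Proof.
move=> mG mf f0.
pose h : R * R -> \bar R := (f \_ G) \o run a.
have mh : measurable_fun setT h.
  apply: measurableT_comp; last exact: measurable_run.
  apply: (measurable_restrictT f mG).1; exact: measurable_funTS.
have h0 z : 0 <= h z by rewrite /h /= patchE; case: ifPn.
have hE x : \int[noise]_(v in run_from a x @^-1` G) f (run_from a x v) =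
    \int[noise]_v h (x, v).
  rewrite integral_mkcond; apply: eq_integral => v _.
  by rewrite /h /= !patchE.
split.
  under eq_fun do rewrite hE.
  exact: (measurable_fun_fubini_tonelli_F h mh h0).
rewrite integral_mkcond ge0_integral_pushforward//=.
- rewrite preimage_setT fubini_tonelli1//.
  by apply: eq_integral => x _; rewrite hE.
- by apply: (measurable_restrictT f mG).1; exact: measurable_funTS.
- by move=> w _; rewrite patchE; case: ifPn.
Qed.

End laws.

Section kernel.
Context {R : realType} {d : nat}.
Local Open Scope ereal_scope.
Variable g : R -> {mfun (R * R)%type >-> R}.

(** The conditional law given the starting point; [coord] extends it from the
    diagonal to all points of the space. *)
Definition law_from (a : R) (y : borelRd R d.+1) :
  {measure set (borel_paths R d.+1) -> \bar R} :=
  distribution noise (run_from g a (coord y)).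

Let measurable_law_from a B : measurable B -> measurable_fun setT (law_from a ^~ B).
Proof.
move=> mB.
exact: (measurableT_comp (measurable_noise_run_from _ _ mB) measurable_coord).
Qed.

HB.instance Definition _ a := isKernel.Build _ _ _ _ _ (law_from a)
  (@measurable_law_from a).

Let law_from_setT a y : law_from a y setT = 1.
Proof. exact: probability_setT. Qed.

HB.instance Definition _ a := Kernel_isProbability.Build _ _ _ _ _ (law_from a)
  (@law_from_setT a).

End kernel.

(** * The initial class *)

Section state_space.
Context {R : realType} {d : nat}.
Local Open Scope ereal_scope.
Notation probRd := (probability (borelRd R d.+1) R).

Definition state (a : R) : probRd := distribution (profile a) (@embed R d.+1).

Lemma stateE a B : state a B = profile a (embed @^-1` B).
Proof. by []. Qed.

Lemma state_atom a b : state a (coord @^-1` [set b]) = if a == b then (2^-1)%R%:E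
  else 0.
Proof.
rewrite stateE (_ : _ @^-1` _ = [set b]); last first.
  by apply/seteqP; split => x /=; rewrite embedK.
rewrite profileE noise_set1 adde0 diracE.
have [->|ab] := eqVneq a b; first by rewrite mem_set// mule1.
by rewrite memNset ?mule0//= => /eqP; exact/negP.
Qed.

(** The atom is the only point of positive mass of a profile. *)
Lemma state_inj a b : state a ≡μ state b -> a = b.
Proof.
move=> ab; have : state a (coord @^-1` [set b]) = state b (coord @^-1` [set b]).
  by apply: ab; rewrite -[X in measurable X]setTI; exact: measurable_coord.
rewrite !state_atom eqxx; case: eqP => // _ /eqP.
by rewrite eqe eq_sym invr_eq0 pnatr_eq0.
Qed.

Definition level_of (eta : probRd) : set R :=
  [set a | (0 <= a <= 1)%R /\ eta ≡μ state a].

Definition states : set probRd := [set eta | level_of eta !=set0].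

(** The position of the atom, read off from the law alone: this is the
    information that the conditional laws of a nonlinear Markov process may
    draw from the present marginal. *)
Definition level (eta : probRd) : R := xget 0%R (level_of eta).

Lemma levelP eta : states eta -> level_of eta (level eta).
Proof. by move=> [a ea]; apply: xgetPex; exists a. Qed.

Lemma level_unique eta a : level_of eta a -> level eta = a.
Proof.
move=> ea; have [_ el] : level_of eta (level eta) by apply: levelP; exists a.
by apply: state_inj => B mB; rewrite -el// ea.2.
Qed.

Lemma level_measure_eq (eta zeta : probRd) :
  eta ≡μ zeta -> level_of eta `<=` level_of zeta.
Proof. by move=> e a [a01 ea]; split => // B mB; rewrite -e// ea. Qed.

Lemma states_proper : proper_class states.
Proof. by move=> eta zeta e [a ea]; exists a; exact: level_measure_eq ea. Qed.

Lemma level_proper (eta zeta : probRd) : eta ≡μ zeta -> states eta ->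
  level zeta = level eta.
Proof. by move=> e /levelP/(level_measure_eq e)/level_unique. Qed.
End state_space.

(** * Rules that define nonlinear Markov processes *)

Section markov.
Context {R : realType} {d : nat}.
Local Open Scope ereal_scope.

Variable g : R -> {mfun (R * R)%type >-> R}.

Definition keeps_behind := forall a x v, (x < a)%R -> g a (x, v) = x.

(** The one-dimensional marginals: while the atom moves from [a] to [b], the
    particles distributed as [profile a] become distributed as
    [profile b]. *)
Definition transports := forall a b, (0 <= a <= b)%R -> (b <= 1)%R ->
  forall B, measurable B ->
  \int[profile a]_x noise [set v | B (pos b (x, g a (x, v)))] = profile b B.

(** The Markov property at the time when the atom, starting from [a], has
    reached [b], for a future time when it will be at [c]. Up to the present,
    the path of a particle depends on its leaving point [y] only through
    [min b y], on which [C] is an arbitrary test; its present position is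
    [pos b (x, y)], from which the left-hand side restarts the rule with fresh
    noise; and [B] tests its future position. For [carry] the identity fails
    at [x = b], whence the exceptional set. *)
Definition forgets := forall a b c, (0 <= a <= b)%R -> (b <= c <= 1)%R ->
  {ae profile a, forall x, forall C B, measurable C -> measurable B ->
    \int[noise]_(v in [set v | C (Num.min b (g a (x, v)))])
       noise [set v' | B (pos c (pos b (x, g a (x, v)), g b (pos b (x, g a (x, v)),
         v')))]
    = noise [set v | C (Num.min b (g a (x, v))) /\ B (pos c (x, g a (x, v)))]}.

Hypotheses (gbehind : keeps_behind) (gtrans : transports) (gforget : forgets).

Lemma marginal_law (a : R) (t : Rplus R) : (0 <= a <= 1)%R ->
  marginal (law (d := d.+1) g a) t ≡μ state (front a (val t)).
Proof.
move=> /andP[a0 a1] B mB.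
have t0 : (0 <= val t)%R := set_valP t.
transitivity (profile (front a (val t)) (@embed R d.+1 @^-1` B)); last by [].
have mB' : measurable (@embed R d.+1 @^-1` B).
  by rewrite -[X in measurable X]setTI; exact: measurable_embed.
have a0t : (0 <= a <= front a (val t))%R by rewrite a0 le_frontr.
rewrite -(gtrans a0t (front_le1 _ _) mB').
transitivity (law (d := d.+1) g a (Defs.proj t @^-1` B)); first exact: erefl.
by rewrite lawE; exact: erefl.
Qed.

Lemma level_marginal a (t : Rplus R) : (0 <= a <= 1)%R ->
  level_of (marginal (law (d := d.+1) g a) t) (front a (val t)).
Proof.
move=> a01; split; last exact: marginal_law.
rewrite front_le1 andbT.
case/andP: a01 => a0 a1; apply: (le_trans a0); apply: le_frontr => //;
  exact: set_valP t.
Qed.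

Lemma pos_start a x v : pos a (x, g a (x, v)) = x.
Proof.
rewrite /pos /=; have [xa|ax] := ltP x a.
  by rewrite gbehind// max_l// ge_min lexx orbT.
by rewrite max_l// ge_min ax.
Qed.

Lemma law_from_disintegration (a : R) : (0 <= a <= 1)%R ->
  is_disintegration (law g a) (law_from (d := d) g a).
Proof.
move=> a01; have a1 : (a <= 1)%R by case/andP: a01.
have mlaw : marginal (law (d := d.+1) g a) Rplus0 ≡μ state a.
  by move=> B mB; rewrite marginal_law//= front0.
split => [B mB|].
  rewrite (eq_measure_integral (state a)); last by move=> A mA _; exact: mlaw.
  rewrite ge0_integral_pushforward//.
  - by rewrite lawE preimage_setT; apply: eq_integral => x _ /=;
    rewrite /law_from embedK.
  - exact: (measurable_kernel (law_from g a) _ mB).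
exists (~` range (@embed R d.+1)); split.
- by apply: measurableC; exact: measurable_range_embed.
- rewrite mlaw; last by apply: measurableC; exact: measurable_range_embed.
  rewrite -[RHS](measure0 (profile a)); apply: (congr1 (profile a)).
  by apply/seteqP; split => // x /=; apply; exists x.
- move=> y /= + [x _ xy]; apply; rewrite -xy.
  rewrite -[RHS](@probability_setT _ _ _ noise); apply: (congr1 noise).
  apply/seteqP; split => // v _ /=; rewrite embedK.
  by apply: (etrans (proj_trajectory _ _ _)); rewrite /= front0// pos_start.
Qed.

(** By Fubini, the defining identity of conditional probabilities reduces to
    one for each starting point [x], and this one is an instance of
    [forgets]. *)
Lemma law_is_cond_prob a (s t : Rplus R) (A : set (borelRd R d.+1)) :
  (0 <= a <= 1)%R -> measurable A ->
  is_cond_prob (law g a) (filtration s) (Defs.proj (Rplus_add t s) @^-1` A)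
    (fun w => law_from g (front a (val s)) (Defs.proj s w) (Defs.proj t @^-1` A)).
Proof.
move=> /andP[a0 a1] mA.
have s0 : (0 <= val s)%R := set_valP s.
have t0 : (0 <= val t)%R := set_valP t.
set b := front a (val s); set c := front b (val t).
have mproj (u : Rplus R) B : measurable B -> measurable (@Defs.proj R d.+1 u @^-1` B).
  by move=> mB; rewrite -[X in measurable X]setTI; exact: measurable_proj.
have mtA := mproj t _ mA.
set f := fun w => _.
have mk : measurable_fun setT (fun y => law_from g b y (Defs.proj t @^-1` A)).
  exact: (measurable_kernel (law_from g b) _ mtA).
have mf : measurable_fun setT f.
  by apply: (measurableT_comp mk); exact: measurable_proj.
have f0 w : 0 <= f w by exact: measure_ge0.
have f1 w : f w <= 1 by exact: probability_le1.
split.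
- move=> _ [Y mY <-]; apply: sub_gen_smallest; exists s => //=.
  exists ((fun y => law_from g b y (Defs.proj t @^-1` A)) @^-1` Y) => //.
  by rewrite -[X in measurable X]setTI; exact: mk.
- apply: (@le_integrable _ _ _ _ _ measurableT _ (EFin \o cst 1%R)) => //.
  + by move=> w _ /=; rewrite gee0_abs// normr1.
  + exact: finite_measure_integrable_cst.
- move=> G sG.
  have mG := filtration_measurable sG.
  have [mI ->] := integral_law g a mG mf f0; rewrite lawE.
  have bb : (0 <= a <= b)%R by rewrite a0 le_frontr.
  have bc : (b <= c <= 1)%R by rewrite le_frontr ?front_le1.
  apply: ge0_ae_eq_integral => //.
  + by apply: measurable_noise_run_from; apply: measurableI => //; exact: mproj.
  + by move=> x _; exact: integral_ge0.
  have := gforget bb bc.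
  apply: filterS => x /(_ [set y | G (trajectory a (x, y))] (@embed R d.+1 @^-1`
    A)) H _.
  have mC : measurable [set y | G (trajectory a (x, y))].
    have mT : measurable_fun setT (fun y => trajectory a (x, y) : borel_paths R d.+1).
      by apply: (measurableT_comp (measurable_trajectory a)); exact: measurable_pair1.
    by rewrite -[X in measurable X]setTI; exact: mT.
  have mB : measurable (@embed R d.+1 @^-1` A).
    by rewrite -[X in measurable X]setTI; exact: measurable_embed.
  (* An event of the past sees the leaving point only up to the present
     position [b] of the atom. *)
  have stopG v : G (run_from g a x v) <-> G (trajectory a (x, Num.min b (g a (x, v)))).
    have agree (u : Rplus R) : (val u <= val s)%R ->
        Defs.proj u (run_from g a x v) =
        Defs.proj u (trajectory a (x, Num.min b (g a (x, v))) : borel_paths R d.+1).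
      move=> us; rewrite /run_from /run; etransitivity; first exact: proj_trajectory.
      etransitivity; last exact/esym/proj_trajectory.
      by rewrite /pos /= minA (min_l (le_front a us)).
    by split; apply: (filtration_agree sG) => u us; rewrite agree.
  have := H mC mB; set D1 := (X in \int[_]_(v in X) _) => HI.
  have DE : run_from g a x @^-1` G = D1.
    by apply/seteqP; split => v /stopG.
  transitivity (\int[noise]_(v in D1) f (run_from g a x v)); first by rewrite DE.
  transitivity (noise [set v | D1 v /\ (embed @^-1` A) (pos c (x, g a (x, v)))]).
    rewrite -[RHS]HI; apply: eq_integral => v _.
    have zE : Defs.proj s (run_from g a x v) = @embed R d.+1 (pos b (x, g a (x, v))).
      by [].
    by rewrite /f zE; apply: (congr1 noise); rewrite embedK.
  apply: (congr1 noise); rewrite -DE.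
  have projts v : Defs.proj (Rplus_add t s) (run_from g a x v) =
      embed (pos c (x, g a (x, v))).
    by rewrite /c /b -front_add// [(val s + val t)%R]addrC; exact: erefl.
  have AE v : A (Defs.proj (Rplus_add t s) (run_from g a x v)) =
      A (embed (pos c (x, g a (x, v)))) by rewrite projts.
  apply/seteqP; split => v [Gv Av]; split => //.
    by have := AE v; rewrite /preimage/= => ->.
  by have := AE v; rewrite /preimage/= => <-.
Qed.

Lemma nonlinear_Markov_law : nonlinear_Markov (@states R d) (fun eta =>
  law g (level eta)).
Proof.
split.
- split; first exact: states_proper.
  by move=> eta zeta P0eta _ ez; rewrite (level_proper ez P0eta).
- move=> zeta /levelP [l01 zl] B mB.
  rewrite (marginal_law Rplus0 l01)// front0 ?zl//.
  by case/andP: l01.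
- by move=> zeta t /levelP [l01 _] _; exists (front (level zeta) (val t));
  exact: level_marginal.
- exists (fun eta => law_from g (level eta)); split.
    by move=> eta /levelP[l01 _]; exact: law_from_disintegration.
  move=> s t zeta A /levelP[l01 _] mA; eexists.
    exact: law_is_cond_prob.
  by apply: aeW => w; rewrite (level_unique (level_marginal s l01)).
Qed.

End markov.

(** * The two rules *)

Section rules.
Context {R : realType}.
Local Open Scope ereal_scope.

Lemma eq_measure_rays (m1 m2 : {measure set R -> \bar R}) :
  (m1 setT < +oo) -> (forall y, m1 `[y, +oo[%classic = m2 `[y, +oo[%classic) ->
  forall A, measurable A -> m1 A = m2 A.
Proof.
move=> fm1 m12; have mG : @measurable _ R = <<s @RGenCInfty.G R >> by exact:
  RGenCInfty.measurableE.
pose ray (k : nat) : set R := `[(- k%:R)%R, +oo[%classic.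
apply: (measure_unique _ ray mG).
- move=> _ _ [x ->] [y ->]; exists (Num.max x y).
  apply/seteqP; split => z /=; rewrite !in_itv/= !andbT ge_max.
    by case=> -> ->.
  by move=> /andP.
- by move=> k; exists (- k%:R)%R.
- apply/seteqP; split => // x _; exists (Num.bound `|x|) => //.
  by rewrite /ray /= in_itv/= andbT lerNl ltW// (le_lt_trans (ler_norm _))//
    normrN archi_boundP.
- by move=> _ [y ->].
- move=> k; apply: le_lt_trans fm1; apply: le_measure => //; rewrite inE;
  [exact: measurable_itv|exact: measurableT].
Qed.

Lemma integral_noise_prop (p : Prop) (B : set R) :
  \int[noise]_(v in [set v | p]) noise B = noise [set v | p /\ B v].
Proof.
have [P|nP] := pselect p.
  have -> : [set v : R | p] = setT by apply/seteqP; split.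
  rewrite integral_cst// [X in _ * X](@probability_setT _ _ _ noise) mule1;
    congr (noise _).
  by apply/seteqP; split => v //= -[].
have -> : [set v : R | p] = set0 by apply/seteqP; split.
rewrite integral_set0 [X in noise X](_ : _ = set0) ?measure0//.
by apply/seteqP; split => v // -[].
Qed.

Lemma noise_cst (B : set R) z : noise [set v : R | B z] = (\1_B z)%:E.
Proof.
have [Bz|nBz] := pselect (B z).
  rewrite indicE mem_set// -(@probability_setT _ _ _ noise); apply: (congr1 noise).
  by apply/seteqP; split.
rewrite indicE memNset//; apply: etrans (measure0 noise); apply: (congr1 noise).
by apply/seteqP; split.
Qed.

(** The particles at the atom ride to the end, and all the others stay. *)
Definition carry_fun (a : R) (z : R * R) : R := if z.1 == a then 1%R else z.1.

(** For uniform [v], [- ln v] is exponential of rate 1; rides end at 1, where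
    the atom stops. The maximum with [x] makes [x <= drop_point x v] hold for
    all [v], including those outside the unit interval. *)
Definition drop_point (x v : R) : R := Num.max x (Num.min 1 (x - ln v))%R.

Definition exchange_fun (a : R) (z : R * R) : R :=
  if (a <= z.1)%R then drop_point z.1 z.2 else z.1.

Lemma measurable_carry a : measurable_fun setT (carry_fun a).
Proof.
apply: measurable_fun_if => //; first exact: measurable_fun_eqr.
exact: measurable_funTS.
Qed.

Lemma measurable_drop_point : measurable_fun setT (fun z : R * R => drop_point z.1 z.2).
Proof.
apply: measurable_maxr => //; apply: measurable_minr => //.
apply: measurable_funB => //.
by apply: measurableT_comp => //; exact: measurable_ln.
Qed.

Lemma measurable_drop_point1 x : measurable_fun setT (drop_point x).
Proof. exact: (measurableT_comp measurable_drop_point (measurable_pair1 x)). Qed.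

Lemma measurable_exchange a : measurable_fun setT (exchange_fun a).
Proof.
apply: measurable_fun_if => //; first exact: measurable_fun_ler.
- by apply: measurable_funTS; exact: measurable_drop_point.
- exact: measurable_funTS.
Qed.

HB.instance Definition _ x := isMeasurableFun.Build _ _ _ _ (drop_point x)
  (measurable_drop_point1 x).
HB.instance Definition _ a := isMeasurableFun.Build _ _ _ _ (carry_fun a)
  (measurable_carry a).
HB.instance Definition _ a := isMeasurableFun.Build _ _ _ _ (exchange_fun a)
  (measurable_exchange a).

Definition carry (a : R) : {mfun (R * R)%type >-> R} := carry_fun a.
Definition exchange (a : R) : {mfun (R * R)%type >-> R} := exchange_fun a.

Lemma carry_keeps_behind : keeps_behind carry.
Proof. by move=> a x v xa; rewrite /= /carry_fun /= lt_eqF. Qed.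

Lemma exchange_keeps_behind : keeps_behind exchange.
Proof. by move=> a x v xa; rewrite /= /exchange_fun /= leNgt xa. Qed.

Lemma drop_point_ge x v : (x <= drop_point x v)%R.
Proof. by rewrite /drop_point le_max lexx. Qed.

Lemma drop_point_tail x y : noise [set v | (y <= drop_point x v)%R] =
  if (y <= x)%R then 1 else if (y <= 1)%R then (expR (x - y))%:E else 0.
Proof.
case: ifPn => [yx|]; last rewrite -ltNge => xy.
  rewrite -(@probability_setT _ _ _ noise); congr (noise _).
  by apply/seteqP; split => v //= _; apply: le_trans (drop_point_ge _ _).
have E v : (y <= drop_point x v)%R = (y <= 1)%R && (0 < v <= expR (x - y))%R.
  rewrite /drop_point le_max leNgt xy /= le_min; congr andb.
  (* Since [ln v = 0] for [v <= 0], no such [v] leads beyond [x]. *)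
  have [v0|v0] := leP v 0%R.
    by rewrite ln0// subr0 leNgt xy.
  by rewrite lerBrDr -lerBrDl -ler_ln ?posrE ?expR_gt0// expRK.
case: ifPn => y1.
  have -> : [set v | (y <= drop_point x v)%R] = `]0%R, (expR (x - y))]%classic.
    by apply/seteqP; split => v /=; rewrite E y1 in_itv.
  rewrite noiseE// setIidl.
    by rewrite lebesgue_measure_itv/= lte_fin expR_gt0 oppr0 adde0.
  move=> v /=; rewrite !in_itv/= => /andP[/ltW -> /le_trans]; apply.
  by rewrite -expR0 ler_expR subr_le0 ltW.
rewrite [X in noise X](_ : _ = set0) ?measure0//.
by apply/seteqP; split => v //=; rewrite E (negbTE y1).
Qed.

(** Both sides are finite measures in [B], and the tails of [drop_point x] are
    exponential up to 1. *)
Lemma drop_point_memoryless x b (B : set R) : (x < b <= 1)%R -> measurable B ->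
  noise [set v | (b <= drop_point x v)%R /\ B (drop_point x v)] =
  (expR (x - b))%:E * noise [set v | B (drop_point b v)].
Proof.
move=> /andP[xb b1] mB.
pose D := [set v | (b <= drop_point x v)%R].
have mD : measurable D.
  rewrite (_ : D = drop_point x @^-1` `[b, +oo[); last first.
    by apply/seteqP; split => v; rewrite /D /= in_itv/= andbT.
  by rewrite -[X in measurable X]setTI; exact: measurable_drop_point1.
pose image : {measure set R -> \bar R} := pushforward (mrestr noise mD) (drop_point x).
pose m1 := image (measurable_drop_point1 x).
pose m2 : {measure set R -> \bar R} :=
  mscale (NngNum (expR_ge0 (x - b))) (distribution noise (drop_point b)).
transitivity (m1 B); first by apply: (congr1 noise); apply/seteqP; split => v [].
transitivity (m2 B); last by [].
apply: eq_measure_rays mB.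
  apply: le_lt_trans (ltry 1%R).
  by apply: (@probability_le1 _ _ _ noise); rewrite preimage_setT setTI.
move=> y.
transitivity (noise [set v | (Num.max b y <= drop_point x v)%R]).
  apply: (congr1 noise); apply/seteqP; split => v; rewrite /= in_itv/= andbT ge_max.
    by case=> -> ->.
  by move=> /andP[? ?]; split.
transitivity ((expR (x - b))%:E * noise [set v | (y <= drop_point b v)%R]); last first.
  by apply: congr1; apply: (congr1 noise); apply/seteqP; split => v;
    rewrite /= in_itv/= andbT.
rewrite !drop_point_tail !ge_max lt_geF//= b1 /=.
have [yb|by_] := leP y b; first by rewrite mule1 (le_trans yb b1).
case: ifPn => _; last by rewrite mule0.
by rewrite -EFinM -expRD; congr (expR _)%:E; lra.
Qed.

(** The background particle sitting exactly at the atom would be carried away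
    too, but it has mass zero. *)
Lemma carry_transports : transports carry.
Proof.
move=> a b /andP[a0 ab] b1 B mB.
pose F (x : R) : \bar R := (\1_B (pos b (x, carry_fun a (x, 0%R))))%:E.
have mF : measurable_fun setT F.
  apply/measurable_EFinP; apply: measurableT_comp => //.
  apply: (measurableT_comp (measurable_pos b)); apply/measurable_fun_pair => //=.
  apply: (measurableT_comp (measurable_carry a)); exact: measurable_pair2.
rewrite (eq_integral F); last by move=> x _; exact: noise_cst.
rewrite integral_profile//; last by move=> x; rewrite lee_fin.
rewrite profileE; congr (_ * (_ + _)).
  by rewrite /F /carry_fun /pos /= eqxx min_l// max_r// indicE diracE.
transitivity (\int[noise]_x (\1_B x)%:E); last by rewrite integral_indic// setIT.
apply: ge0_ae_eq_integral => //.
- by apply/measurable_EFinP; exact: measurable_indic.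
- by move=> x _; rewrite lee_fin.
exists [set a]; split => //; first exact: noise_set1.
move=> x /= H; apply: contrapT => /eqP xa; apply: H => _.
by rewrite /F /carry_fun /pos /= (negbTE xa) max_l// ge_min lexx orbT.
Qed.

(** Restarting at [b] moves a background particle that rests at [x = b]; only
    this starting point has to be excluded, and it has mass zero unless it
    is the atom itself. *)
Lemma carry_forgets : forgets carry.
Proof.
move=> a b c /andP[a0 ab] /andP[bc c1]; have b1 := le_trans bc c1.
exists ([set b] `\ a); split.
- exact: measurableD.
- rewrite profileE diracE memNset/=; last by case.
  rewrite add0e; suff -> : noise ([set b] `\ a) = 0 by rewrite mule0.
  have mN : measurable ([set b] `\ a) by exact: measurableD.
  by apply: (subset_measure0 mN (measurable_set1 b)); [move=> ? []|exact: noise_set1].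
move=> x /= nforget; apply: contrapT => xN; apply: nforget => C B mC mB.
rewrite /carry_fun /=; case: ifPn => [/eqP ->|xa].
  have -> : pos b (a, 1%R) = b by rewrite /pos /= min_l// max_r.
  rewrite eqxx integral_noise_prop.
  suff -> : pos c (a, 1%R) = pos c (b, 1%R) by [].
  by rewrite /pos /= min_l// !max_r// (le_trans ab bc).
have xb : x != b by apply/eqP => xb; apply: xN; split => //=; exact/eqP.
by rewrite !pos_diag (negbTE xb) integral_noise_prop pos_diag.
Qed.

(** A particle left before the atom reaches [b] has no future randomness, and
    one with [b <= x] has no past. The remaining case, a particle in the atom
    at [b], is memorylessness. *)
Lemma exchange_forgets : forgets exchange.
Proof.
move=> a b c /andP[a0 ab] /andP[bc c1]; have b1 := le_trans bc c1.
apply: aeW => x C B mC mB; rewrite /= /exchange_fun /=.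
have [ax|xa] := leP a x; last first.
  have xb : (x < b)%R := lt_le_trans xa ab.
  by rewrite !pos_diag leNgt xb/= integral_noise_prop pos_diag.
have [bx|xb] := leP b x.
  have minb v : Num.min b (drop_point x v) = b by rewrite min_l//
    (le_trans bx (drop_point_ge _ _)).
  have posb v : pos b (x, drop_point x v) = x by rewrite /pos /= minb max_l.
  under eq_integral do rewrite posb bx.
  have -> : [set v | C (Num.min b (drop_point x v))] = [set v | C b].
    by apply/seteqP; split => v /=; rewrite minb.
  by rewrite integral_noise_prop; apply: (congr1 noise); apply/seteqP; split => v /=;
    rewrite minb.
(* From here on [a <= x < b]. [E] is the event that the particle is in the atom
   when the atom is at [b]. *)
pose D := [set v | C (Num.min b (drop_point x v))].
pose E := [set v | (b <= drop_point x v)%R].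
have mE : measurable E.
  rewrite (_ : E = drop_point x @^-1` `[b, +oo[); last first.
    by apply/seteqP; split => v; rewrite /E /= in_itv/= andbT.
  by rewrite -[X in measurable X]setTI; exact: measurable_drop_point1.
have mD : measurable D.
  rewrite (_ : D = (fun v => Num.min b (drop_point x v)) @^-1` C)//.
  rewrite -[X in measurable X]setTI.
  by apply: measurable_minr => //; exact: measurable_drop_point1.
pose k (v : R) := noise [set v' | B (pos c (pos b (x, drop_point x v),
  if (b <= pos b (x, drop_point x v))%R then drop_point (pos b (x, drop_point x v))
    v' else pos b (x, drop_point x v)))].
have kE v : E v -> k v = noise [set v' | B (pos c (b, drop_point b v'))].
  rewrite /E /k /= => bY.
  have -> : pos b (x, drop_point x v) = b by rewrite /pos /= (min_l bY) max_r// ltW.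
  by rewrite lexx.
have kN v : ~ E v -> k v = (\1_(drop_point x @^-1` B) v)%:E.
  move=> /negP; rewrite /k /= -ltNge => Yb.
  have -> : pos b (x, drop_point x v) = drop_point x v.
    by rewrite /pos /= (min_r (ltW Yb)) max_r// drop_point_ge.
  by rewrite leNgt Yb /= pos_diag noise_cst.
have mhB : measurable (drop_point x @^-1` B).
  by rewrite -[X in measurable X]setTI; exact: measurable_drop_point1.
have mkE : measurable_fun E k.
  by apply: (eq_measurable_fun (cst (noise [set v' | B (pos c (b, drop_point b
    v'))]))) => // v /[!inE] /kE.
have mkN : measurable_fun (~` E) k.
  apply: (eq_measurable_fun (fun v => (\1_(drop_point x @^-1` B) v)%:E));
    first by move=> v /[!inE] /kN.
  by apply: measurable_funTS; apply/measurable_EFinP; exact: measurable_indic.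
have splitE (A : set R) : A = (A `&` E) `|` (A `&` ~` E) by rewrite -setIUr setUv setIT.
have mDE : measurable (D `&` E) by exact: measurableI.
have mDN : measurable (D `&` ~` E) by apply: measurableI => //; exact: measurableC.
have mk : measurable_fun setT k.
  have -> : [set: R] = E `|` ~` E by rewrite setUv.
  by apply: (measurable_funU k mE (measurableC mE)).2.
pose S := [set v | C (Num.min b (drop_point x v)) /\ B (pos c (x, drop_point x v))].
have SE : S `&` E = [set v | C b /\ (E v /\ B (Num.min c (drop_point x v)))].
  apply/seteqP; split => v; rewrite /S /E /= => -[+ +].
    move=> [Cv Bv] bY; rewrite min_l// in Cv; split => //; split => //.
    by move: Bv; rewrite /pos /= max_r// le_min drop_point_ge (le_trans (ltW xb) bc).
  move=> Cb [bY Bv]; rewrite min_l//; split => //; split => //.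
  by rewrite /pos /= max_r// le_min drop_point_ge (le_trans (ltW xb) bc).
have SN : S `&` ~` E = (D `&` ~` E) `&` (drop_point x @^-1` B).
  have posN v : ~ E v -> pos c (x, drop_point x v) = drop_point x v.
    move=> /negP; rewrite /E /= -ltNge => Yb.
    by rewrite /pos /= (min_r (ltW (lt_le_trans Yb bc))) max_r// drop_point_ge.
  apply/seteqP; split => v /= [].
    by move=> [Dv Bv] nE; rewrite posN// in Bv.
  by move=> [Dv nE] Bv; split => //; split => //; rewrite posN.
have mB' : measurable [set y | B (Num.min c y)].
  rewrite -[X in measurable X]setTI.
  have : measurable_fun setT (fun y : R => Num.min c y) by exact: measurable_minr.
  by move=> /(_ measurableT _ mB).
have mEB : measurable [set v | E v /\ B (Num.min c (drop_point x v))].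
  apply: measurableI => //.
  by have := @measurable_drop_point1 x measurableT _ mB'; rewrite setTI.
have mSE : measurable (S `&` E).
  rewrite SE; have [Cb|nCb] := pselect (C b).
    by rewrite (_ : mkset _ = [set v | E v /\ B (Num.min c (drop_point x v))])//;
      apply/seteqP; split => v //= -[].
  by rewrite (_ : mkset _ = set0)//; apply/seteqP; split => v //= -[].
have mSN : measurable (S `&` ~` E) by rewrite SN; exact: measurableI.
transitivity (\int[noise]_(v in D) k v) => //.
transitivity (\int[noise]_(v in D `&` E) k v + \int[noise]_(v in D `&` ~` E) k v).
  rewrite -ge0_integral_setU//.
  - by rewrite -splitE.
  - by rewrite -splitE; exact: measurable_funTS.
  - by apply/disj_setPS => v [[_ Ev] [_ nE]].
transitivity (noise (S `&` E) + noise (S `&` ~` E)); last first.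
  rewrite -measureU//.
    by rewrite -splitE.
  by apply/seteqP; split => v // -[[_ Ev] [_ nE]].
congr (_ + _); last first.
  rewrite SN (eq_integral (fun v => (\1_(drop_point x @^-1` B) v)%:E)).
    by rewrite integral_indic// setIC.
  by move=> v /[!inE] -[_ nE]; exact: kN.
rewrite (eq_integral (fun=> noise [set v' | B (pos c (b, drop_point b v'))]));
  last first.
  by move=> v /[!inE] -[_ Ev]; exact: kE.
rewrite SE; have [Cb|nCb] := pselect (C b); last first.
  rewrite [X in _ = noise X](_ : _ = set0); last by apply/seteqP; split => v //= -[].
  rewrite (_ : D `&` E = set0) ?integral_set0 ?measure0//.
  by apply/seteqP; split => v //= -[]; rewrite /D /E /= => + bY; rewrite min_l.
rewrite [X in _ = noise X](_ : _ = [set v | E v /\ B (Num.min c (drop_point x v))]);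
  last first.
  by apply/seteqP; split => v //= -[].
rewrite (_ : D `&` E = E); last first.
  by apply/seteqP; split => v //=; [case|rewrite /D /E /= => bY; rewrite min_l].
rewrite integral_cst// (drop_point_memoryless _ mB') ?xb// muleC.
have noiseEE : noise E = (expR (x - b))%:E by rewrite drop_point_tail leNgt xb b1.
rewrite [X in X * _ = _]noiseEE; congr (_ * noise _).
by apply/seteqP; split => v /=; rewrite /pos /= max_r// le_min bc; exact: drop_point_ge.
Qed.

Lemma integral_expR_shift (a y : R) : (a < y)%R ->
  \int[lebesgue_measure]_(x in `[a, y[) (expR (x - y))%:E = (1 - expR (a - y))%:E.
Proof.
move=> ay.
have dF (x : R) : is_derive x 1%R (fun x => expR (x - y)) (expR (x - y)).
  rewrite -[X in is_derive _ _ _ X]mulr1.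
  apply: (@is_derive1_comp _ expR (fun x : R => x - y)%R).
  by apply: is_derive_eq; rewrite subr0.
have cF : continuous (fun x => expR (x - y)) .
  by move=> x; apply/differentiable_continuous/derivable1_diffP; have [] := dF x.
rewrite integral_itv_bndo_bndc.
  rewrite (@continuous_FTC2 _ _ (fun x => expR (x - y)))//.
  - by rewrite /= subrr expR0 -EFinB.
  - exact: continuous_subspaceT.
  - split.
    + by move=> x _; have [] := dF x.
    + exact: (cvg_at_right_filter (cF a)).
    + exact: (cvg_at_left_filter (cF y)).
  - by move=> x _; rewrite derive1E; apply: derive_val.
apply/measurable_EFinP; apply: measurable_funTS.
exact: continuous_measurable_fun.
Qed.

(** It suffices to compare the masses of the half-lines from [y] on. When
    [a < y <= b], those of the particles of the atom that pass [y] have mass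
    [expR (a - y) / 2], and the picked up background particles that pass [y]
    make up the rest of the mass 1/2 of the atom at [b]. *)
Lemma exchange_transports : transports exchange.
Proof.
move=> a b /andP[a0 ab] b1.
pose h (z : R * R) := pos b (z.1, exchange a z).
have mh : measurable_fun setT h.
  apply: (measurableT_comp (measurable_pos b)); apply/measurable_fun_pair => //=.
pose image : {measure set R -> \bar R} := pushforward (profile a \x noise) h.
pose m := image mh.
have mE B : m B = \int[profile a]_x noise [set v | B (pos b (x, exchange a (x, v)))].
  apply: eq_integral => x _ /=; apply: (congr1 noise).
  by apply/seteqP; split => v; rewrite /xsection /= inE.
move=> B mB; rewrite -mE; apply: eq_measure_rays mB.
  apply: (@le_lt_trans _ _ 1); last exact: ltry.
  by apply: (@probability_le1 _ _ _ (profile a \x noise)); rewrite preimage_setT.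
move=> y; rewrite mE.
pose ray : set R := `[y, +oo[%classic.
have mray : measurable ray by exact: measurable_itv.
(* [S x] is the probability that a particle starting from [x] is at or beyond
   [y] when the atom is at [b]. *)
pose S (x : R) : \bar R := if (y <= x)%R then 1 else
  if (y <= b)%R && (a <= x)%R then (expR (x - y))%:E else 0.
have S0 x : 0 <= S x by rewrite /S; case: ifPn => // _; case: ifPn => // _;
  rewrite lee_fin expR_ge0.
have SE x : noise [set v | ray (pos b (x, exchange a (x, v)))] = S x.
  have rayP v : ray (pos b (x, exchange a (x, v))) =
      ((y <= x) || (y <= b) && (y <= exchange a (x, v)))%R :> Prop.
    by rewrite /ray /pos /= in_itv/= andbT le_max le_min.
  under eq_set do rewrite rayP.
  rewrite /S; have [yx|xy] := leP y x.
    rewrite -(@probability_setT _ _ _ noise); apply: (congr1 noise).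
    by apply/seteqP; split.
  have [yb|by_] := leP y b; last first.
    by apply: etrans (measure0 noise); apply: (congr1 noise); apply/seteqP; split.
  rewrite /= /exchange_fun /=; case: ifPn => ax.
    by rewrite drop_point_tail leNgt xy (le_trans yb b1).
  apply: etrans (measure0 noise); apply: (congr1 noise); apply/seteqP; split => // v /=.
  by rewrite leNgt xy.
have mS : measurable_fun setT S.
  have -> : S = noise \o xsection (h @^-1` ray).
    apply/funext => x /=; rewrite -SE; apply: (congr1 noise).
    by apply/seteqP; split => v; rewrite /xsection /= inE.
  by apply: measurable_fun_xsection; rewrite -[X in measurable X]setTI;
    exact: (mh measurableT _ mray).
rewrite (eq_integral S); last by move=> x _; exact: SE.
rewrite integral_profile//; apply: etrans (esym (profileE b ray)); congr (_ * _).
have rayE x : (x \in ray) = (y <= x)%R.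
  by apply/idP/idP; rewrite inE /ray /= in_itv/= andbT.
have ray1 : \int[noise]_x (\1_ray x)%:E = noise ray by rewrite integral_indic// setIT.
rewrite diracE rayE.
have [yb|by_] := leP y b; last first.
  rewrite (_ : S a = 0); last by rewrite /S leNgt (le_lt_trans ab by_)/= leNgt by_.
  rewrite !add0e -ray1; apply: eq_integral => x _.
  by rewrite indicE rayE /S (lt_geF by_); case: ifPn.
have [ya|ay] := leP y a.
  rewrite (_ : S a = 1); last by rewrite /S ya.
  congr (_ + _); rewrite -ray1; apply: eq_integral => x _.
  rewrite indicE rayE /S yb /=; case: ifPn => //; rewrite -ltNge => xy.
  by rewrite leNgt (lt_le_trans xy ya).
(* [T] is the contribution of the background particles that the atom carries
   past [y]. *)
pose T : R -> \bar R := (fun x => (expR (x - y))%:E) \_ `[a, y[.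
have T0 x : 0 <= T x by rewrite /T patchE; case: ifPn => // _; rewrite lee_fin expR_ge0.
have mT : measurable_fun setT T.
  apply: (measurable_restrictT _ (measurable_itv _)).1; apply: measurable_funTS.
  apply/measurable_EFinP; apply: measurableT_comp => //; exact: measurable_funB.
rewrite (_ : S a = (expR (a - y))%:E); last by rewrite /S leNgt ay/= yb lexx.
rewrite (eq_integral (fun x => (\1_ray x)%:E + T x)); last first.
  move=> x _; rewrite indicE rayE /S /T patchE yb /= mem_setE in_itv/=.
  have [yx|xy] := leP y x; first by rewrite andbF adde0.
  by rewrite andbT add0e.
rewrite ge0_integralD//; last by apply/measurable_EFinP; exact: measurable_indic.
rewrite ray1 addeCA integral_noise// -integral_mkcondr.
rewrite [X in \int[_]_(_ in X) _](_ : _ = `[a, y[%classic); last first.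
  apply/seteqP; split => x /=; rewrite !in_itv/=; first by case.
  move=> /andP[ax xy]; rewrite ax xy (le_trans a0 ax); split => //.
  by rewrite (le_trans (ltW xy)) // (le_trans yb).
by rewrite integral_expR_shift// -EFinD addrCA subrr addr0 addeC.
Qed.

End rules.

(** * The two processes differ *)

Section distinct.
Context {R : realType} {n : nat}.
Local Open Scope ereal_scope.

Lemma Rplus1_subproof : (1 : R)%R \in Rplus R.
Proof. by apply/mem_set; exact: ler01. Qed.

Definition Rplus1 : Rplus R := exist _ 1%R Rplus1_subproof.

(** The particle starts from 0 and is at 1 at time 1: when the atom starts from
    0 as well, this means that it never leaves the atom. *)
Definition crossing : set (borel_paths R n.+1) :=
  Defs.proj Rplus0 @^-1` (coord @^-1` [set 0%R]) `&`
  Defs.proj Rplus1 @^-1` (coord @^-1` [set 1%R]).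

Lemma measurable_crossing : measurable crossing.
Proof.
have mc (t : Rplus R) (x : R) :
    measurable (@Defs.proj R n.+1 t @^-1` (coord @^-1` [set x])).
  rewrite -[X in measurable X]setTI; apply: measurable_proj => //.
  by rewrite -[X in measurable X]setTI; exact: measurable_coord.
by apply: measurableI; exact: mc.
Qed.

Lemma law_crossing (g : R -> {mfun (R * R)%type >-> R}) : keeps_behind g ->
  law g 0%R crossing =
  (2^-1)%R%:E * noise [set v | (1 <= g 0%R (0%R, v))%R].
Proof.
move=> gb; rewrite lawE integral_profile//; last first.
  exact: (measurable_noise_run_from g _ measurable_crossing).
have start x v : coord (Defs.proj Rplus0 (run_from g 0%R x v : borel_paths R n.+1)) = x.
  have -> : Defs.proj Rplus0 (run_from g 0%R x v) =
    @embed R n.+1 (pos (front 0 0) (x, g 0 (x, v)))%R by [].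
  by rewrite embedK front0// pos_start.
have stop x v : coord (Defs.proj Rplus1 (run_from g 0%R x v : borel_paths R n.+1)) =
    pos 1%R (x, g 0%R (x, v)).
  have -> : Defs.proj Rplus1 (run_from g 0%R x v) =
    @embed R n.+1 (pos (front 0 1) (x, g 0 (x, v)))%R by [].
  by rewrite embedK /front add0r minxx.
have crossE x v : crossing (run_from g 0%R x v) <->
    x = 0%R /\ pos 1%R (x, g 0%R (x, v)) = 1%R.
  by rewrite -{2}(start x v) -stop.
have only0 x : x != 0%R -> noise (run_from g 0%R x @^-1` crossing) = 0.
  move=> x0; apply: etrans (measure0 noise); apply: (congr1 noise).
  by apply/seteqP; split => // v /crossE[/eqP]; rewrite (negbTE x0).
congr (_ * _); rewrite [X in _ + X](_ : _ = 0).
  rewrite adde0; apply: (congr1 noise); apply/seteqP; split => v.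
    move=> /crossE[_] p1; have : (1 <= pos 1 (0, g 0 (0, v)))%R by rewrite p1.
    by rewrite /pos /= le_max ler10 /= le_min => /andP[].
  by move=> /= gv; apply/crossE; split => //; rewrite /pos /= min_l// max_r.
rewrite -(integral0 noise setT); apply: ge0_ae_eq_integral => //.
  exact: (measurable_noise_run_from g _ measurable_crossing).
exists [set 0%R]; split => //; first exact: noise_set1.
by move=> x /= nx; apply: contrapT => /eqP x0; apply: nx => _; exact: only0.
Qed.

Lemma laws_differ : ~ (law (d := n.+1) (@carry R) 0%R ≡μ law (@exchange R) 0%R).
Proof.
move=> PQ; have : law (@carry R) 0%R crossing = law (@exchange R) 0%R crossing.
  exact: PQ measurable_crossing.
rewrite (law_crossing (@carry_keeps_behind R)) (law_crossing
  (@exchange_keeps_behind R)).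
rewrite /= /carry_fun /exchange_fun /= eqxx lexx drop_point_tail ler10 lexx.
rewrite (_ : [set v | _] = setT); last by apply/seteqP; split => // v _ /=;
  rewrite lexx.
rewrite [in LHS](@probability_setT _ _ _ noise) mule1 -EFinM => -[/eqP].
rewrite -[X in X == _]mulr1 (inj_eq (mulfI _)) ?invr_eq0 ?pnatr_eq0// => /eqP e1.
have : (expR (0 - 1) < 1 :> R)%R by rewrite expR_lt1 sub0r oppr_lt0 ltr01.
by rewrite -e1 ltxx.
Qed.
End distinct.

Theorem theorem1p1 (R : realType) (d : nat) (d_gt0 : (0 < d)%N) :
  exists (P0 : set (probability (borelRd R d) R))
         (P Q : probability (borelRd R d) R -> probability (borel_paths R d) R),
    [/\ nonlinear_Markov P0 P,
        nonlinear_Markov P0 Q,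
        forall zeta (t : Rplus R), P0 zeta ->
          marginal (P zeta) t ≡μ marginal (Q zeta) t &
        exists2 zeta, P0 zeta & ~ (P zeta ≡μ Q zeta)].
Proof.
case: d d_gt0 => // n _.
exists (@states R n), (fun zeta => law (@carry R) (level zeta)),
  (fun zeta => law (@exchange R) (level zeta)); split.
- exact: (nonlinear_Markov_law (@carry_keeps_behind R) (@carry_transports R)
  (@carry_forgets R)).
- exact: (nonlinear_Markov_law (@exchange_keeps_behind R) (@exchange_transports R)
  (@exchange_forgets R)).
- move=> zeta t /levelP[l01 _] B mB.
  by rewrite (marginal_law (@carry_transports R))//
    (marginal_law (@exchange_transports R)).
have l0 : level_of (state 0%R : probability (borelRd R n.+1) R) 0%R.
  by split; first rewrite lexx ler01.
exists (state 0%R); first by exists 0%R.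
by rewrite (level_unique l0); exact: laws_differ.
Qed.
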